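(* Let $X$ be a subset of $\mathbb{N}\setminus\{0\}$. Then $Coe(X)$ is the submonoid of $(\mathbb{N},+)$ generated by $$X\cup\{x+1\mid x\text{ is an odd element of }X\}\cup\{x-1\mid x\text{ is an odd element of }X\}.$$
   Context: $\mathbb{N}=\{0,1,2,\ldots\}$. A submonoid of $(\mathbb{N},+)$ is a subset of $\mathbb{N}$ containing $0$ and closed under addition; it is a numerical semigroup if its complement in $\mathbb{N}$ is finite. The submonoid generated by a set is the smallest submonoid containing it (the empty set generates $\{0\}$). A numerical semigroup $S$ is a Coe-semigroup if $\{x-1,x+1\}\subseteq S$ for every odd $x\in S$. A Coe-monoid is a submonoid of $(\mathbb{N},+)$ that can be expressed as an intersection of a (finite or infinite) family of Coe-semigroups. For $X\subseteq\mathbb{N}$, $Coe(X)$ denotes the intersection of all Coe-monoids containing $X$, i.e. the smallest Coe-monoid containing $X$. *)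

(* Defs.v *)
From mathcomp Require Export all_boot.
From mathcomp Require Export classical_sets cardinality.

Set Implicit Arguments.
Unset Strict Implicit.
Unset Printing Implicit Defensive.

Local Open Scope classical_set_scope.

Definition submonoid (M : set nat) : Prop :=
  M 0 /\ forall x y, M x -> M y -> M (x + y).

Definition numerical_semigroup (S : set nat) : Prop :=
  submonoid S /\ finite_set (~` S).

(* The subtraction is truncated, but an odd x satisfies 1 <= x. *)
Definition Coe_semigroup (S : set nat) : Prop :=
  numerical_semigroup S /\
  forall x, odd x -> S x -> [set x - 1; x + 1] `<=` S.

(* The empty family is allowed: its intersection is the full set of natural
   numbers, which is itself a Coe-semigroup. *)
Definition Coe_monoid (M : set nat) : Prop :=
  submonoid M /\
  exists F : set (set nat),
    (forall S, F S -> Coe_semigroup S) /\ M = \bigcap_(S in F) S.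

(* [smallest C A] is the intersection of all sets containing A that satisfy
   C. *)
Definition generated_submonoid (A : set nat) : set nat := smallest submonoid A.

Definition Coe (X : set nat) : set nat := smallest Coe_monoid X.

(* Main.v *)
(** The submonoid [G] generated by the right-hand side inherits closure under
    [x |-> x - 1] and [x |-> x + 1] for odd [x], because an odd sum has an odd
    summand that can absorb the shift.  Such a [G] is the intersection of the
    Coe-semigroups [G `|` [set y | 2 * n <= y]]; the threshold is even so that
    the predecessor of an odd element above it stays above it. *)
Require Import Defs.
From mathcomp Require Import all_boot.
From mathcomp Require Import classical_sets cardinality.
From mathcomp Require Import zify.

Local Open Scope classical_set_scope.

(** The Coe condition without cofiniteness; among submonoids it characterizes the Coe-monoids. *)
Definition odd_neighbour_closed (M : set nat) : Prop :=
  forall x, odd x -> M x -> [set x - 1; x + 1] `<=` M.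

Lemma generated_submonoidP (A : set nat) : submonoid (generated_submonoid A).
Proof.
split=> [M [[M0 _] _] //|x y Gx Gy M CM].
by case: (CM) => -[_ MD] _; apply: MD; [apply: Gx|apply: Gy].
Qed.

Lemma Coe_monoid_odd_neighbour_closed (M : set nat) :
  Coe_monoid M -> odd_neighbour_closed M.
Proof.
move=> [_ [F [FC ->]]] x ox Mx y xy S FS.
by have [_ Sodd] := FC _ FS; apply: (Sodd x ox (Mx _ FS)).
Qed.

Lemma Coe_semigroup_setU_tail (M : set nat) (n : nat) :
  submonoid M -> odd_neighbour_closed M ->
  Coe_semigroup (M `|` [set y | 2 * n <= y]).
Proof.
move=> [M0 MD] Modd; split; first split.
- split=> [|x y [Mx|/= nx] [My|/= ny]]; first (by left);
    [by left; apply: MD|right => /=; lia..].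
- apply: (sub_finite_set _ (finite_II (2 * n))) => y ny /=.
  by rewrite ltnNge; apply/negP => ly; apply: ny; right.
- move=> x ox [Mx|/= nx] y.
    by move=> xy; left; apply: (Modd x).
  by case=> -> /=; right => /=; lia.
Qed.

Lemma odd_neighbour_closed_Coe_monoid (M : set nat) :
  submonoid M -> odd_neighbour_closed M -> Coe_monoid M.
Proof.
move=> Mmon Modd; split=> //.
exists (range (fun n => M `|` [set y | 2 * n <= y])); split.
  by move=> _ [n _ <-]; apply: Coe_semigroup_setU_tail.
(* The index [y.+1] puts the tail's threshold [2 * y.+1] above [y], so [y] can only come from
   [M]. *)
apply/seteqP; split=> [y My _ [n _ <-]|y /(_ _ (imageT _ y.+1))]; first by left.
by case=> //= ?; lia.
Qed.

Lemma generated_submonoid_odd_neighbour_closed (A : set nat) :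
  (forall x, odd x -> A x -> [set x - 1; x + 1] `<=` generated_submonoid A) ->
  odd_neighbour_closed (generated_submonoid A).
Proof.
move=> Aodd; have [G0 GD] := generated_submonoidP A.
set G := generated_submonoid A in Aodd G0 GD *.
(* Induction on generation: the right-hand set is a submonoid containing [A], so minimality of [G]
   applies. *)
suff GT : G `<=` [set x | G x /\ (odd x -> [set x - 1; x + 1] `<=` G)].
  by move=> x ox /GT[_]; apply.
apply: smallest_sub; last first.
  by move=> x Ax; split=> [|ox]; [exact: sub_gen_smallest|exact: Aodd].
split=> [//|x y [Gx xG] [Gy yG]]; split=> [|oxy]; first exact: GD.
(* The odd summand takes the shift; being at least 1, it makes the truncated subtraction exact. *)
have [ox|ex] := boolP (odd x).
  move=> _ [] ->.
  - have -> : x + y - 1 = (x - 1) + y by lia.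
    by apply: GD => //; apply: (xG ox); left.
  - have -> : x + y + 1 = (x + 1) + y by lia.
    by apply: GD => //; apply: (xG ox); right.
have oy : odd y by lia.
move=> _ [] ->.
- have -> : x + y - 1 = x + (y - 1) by lia.
  by apply: GD => //; apply: (yG oy); left.
- have -> : x + y + 1 = x + (y + 1) by lia.
  by apply: GD => //; apply: (yG oy); right.
Qed.

Theorem corollary35 (X : set nat) (hX : X `<=` [set~ 0]) :
  Coe X =
  generated_submonoid
    (X `|` [set x + 1 | x in [set x | X x /\ odd x]]
       `|` [set x - 1 | x in [set x | X x /\ odd x]]).
Proof.
apply/seteqP; split.
- apply: smallest_sub; last by move=> x Xx; apply: sub_gen_smallest; left; left.
  apply: odd_neighbour_closed_Coe_monoid; first exact: generated_submonoidP.
  apply: generated_submonoid_odd_neighbour_closed => x ox.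
  (* The added generators [z + 1] and [z - 1] are even, so an odd generator lies in [X]. *)
  case=> [[Xx|[z [_ oz] zx]]|[z [_ oz] zx]]; [|exfalso; lia..].
  move=> _ [] ->; apply: sub_gen_smallest; [right|left; right]; by exists x.
(* Any Coe-monoid containing [X] is a submonoid containing all the generators. *)
- move=> y Gy M [CM XM]; have Modd := Coe_monoid_odd_neighbour_closed M CM.
  apply: Gy; split; first by case: CM.
  move=> z [[/XM//|[x [Xx ox] <-]]|[x [Xx ox] <-]];
    apply: (Modd x ox (XM _ Xx)); [by right|by left].
Qed.
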